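(* Let $m\ge 1$, $p,q\ge 0$ with $p+q>1$, and $r,s\ge 0$ be integers, and let $n\ge 1$. Then: (i) if $q=0$, $$G_{n,p,0}^{r,s,m}=G_{n+r,p,0}^{0,0,m}-G_{r,p,0}^{0,0,m}-\sum_{i=1}^{r}R_{n,m,p}^{i,r};$$ (ii) if $p>q$ and $r\neq s$, $$G_{n,p,q}^{r,s,m}=\frac{1}{(s-r)^{q}}\sum_{i=0}^{q}(-1)^{i}\binom{q}{i}G_{n,p-i,i}^{r,s,m};$$ (iii) if $p<q$ and $r\neq s$, $$G_{n,p,q}^{r,s,m}=\frac{1}{(r-s)^{p}}\sum_{i=0}^{p}(-1)^{i}\binom{p}{i}G_{n,i,q-i}^{r,s,m}.$$
   Context: For integers $j\ge 0$, $m\ge1$, $H_{j,m}=\sum_{i=1}^{j}i^{-m}$ (so $H_{0,m}=0$); empty sums are $0$. For integers $N\ge0$, $p,q\ge0$, $r,s\ge0$: $G_{N,p,q}^{r,s,m}=\sum_{j=1}^{N}\frac{H_{j,m}}{(j+r)^{p}(j+s)^{q}}$ and $R_{N,p,q}^{r,s}=\sum_{j=1}^{N}\frac{1}{(j+r)^{p}(j+s)^{q}}$. *)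

(* Defs.v *)
From mathcomp Require Import all_boot all_order all_algebra.

Set Implicit Arguments.
Unset Strict Implicit.
Unset Printing Implicit Defensive.

Import GRing.Theory.
Local Open Scope ring_scope.

Definition H (j m : nat) : rat := \sum_(1 <= i < j.+1) i%:R ^- m.

(* [G N p q r s m] is G_{N,p,q}^{r,s,m}: subscripts first, then superscripts. *)
Definition G (N p q r s m : nat) : rat :=
  \sum_(1 <= j < N.+1) H j m / ((j + r)%:R ^+ p * (j + s)%:R ^+ q).

(* [R N p q r s] is R_{N,p,q}^{r,s}. *)
Definition R (N p q r s : nat) : rat :=
  \sum_(1 <= j < N.+1) 1 / ((j + r)%:R ^+ p * (j + s)%:R ^+ q).

(* Main.v *)
Require Import Defs.
From mathcomp Require Import all_boot all_order all_algebra ring.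

Set Implicit Arguments.
Unset Strict Implicit.
Unset Printing Implicit Defensive.

Import GRing.Theory.
Local Open Scope ring_scope.

(** All three identities hold term by term in [j]. For (ii), put [a = j + r] and [b = j + s]:
    expanding [(1 - a / b) ^+ q = ((b - a) / b) ^+ q] splits [1 / (a ^+ p * b ^+ q)], and
    [b - a = s - r] is free of [j], so summing against [H j m] gives [G_binomial]. Case (iii) is
    (ii) with [(p, r)] and [(q, s)] exchanged ([G_sym]). For (i), shifting the index by [r] replaces
    [H j m] by [H (j + r) m]; the excess, given by [H_addn], sums to the [R] terms ([G_shift]). *)

Lemma inv_expM_binomial (F : fieldType) (a b : F) (p q : nat) :
    a != 0 -> b != 0 -> a != b -> (q <= p)%N ->
  (a ^+ p * b ^+ q)^-1 =
    1 / (b - a) ^+ q *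
      \sum_(0 <= i < q.+1) (-1) ^+ i * 'C(q, i)%:R / (a ^+ (p - i) * b ^+ i).
Proof.
move=> a0 b0 ab le_qp.
(* The sum is a^-p (1 - a/b)^q, since a^-(p-i) b^-i = a^-p (a/b)^i. *)
have -> : \sum_(0 <= i < q.+1) (-1) ^+ i * 'C(q, i)%:R / (a ^+ (p - i) * b ^+ i)
          = a ^- p * (1 - a / b) ^+ q.
  rewrite exprBn big_distrr big_mkord; apply: eq_bigr => -[i /= lt_iq] _.
  (* Thus the natural-number subtraction [p - i] is not truncated, and [a ^+ (p - i)] is
     [a ^+ p / a ^+ i]. *)
  have le_ip : (i <= p)%N by apply: leq_trans le_qp.
  rewrite expr1n mulr1 -[_ *+ 'C(q, i)]mulr_natr expfB_cond ?(negPf a0) //.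
  by rewrite invfM invf_div expr_div_n; ring.
have ba0 : (b - a) ^+ q != 0 by rewrite expf_neq0 // subr_eq0 eq_sym.
have -> : 1 - a / b = (b - a) / b by rewrite mulrBl divff.
by rewrite expr_div_n invfM mul1r mulrCA mulKf.
Qed.

Lemma natrD_neq0 (j r : nat) : (0 < j)%N -> (j + r)%:R != 0 :> rat.
Proof. by move=> j0; rewrite Num.Theory.pnatr_eq0 addn_eq0 negb_and -lt0n j0. Qed.

Lemma G_sym (n p q r s m : nat) : G n p q r s m = G n q p s r m.
Proof. by apply: eq_bigr => j _; rewrite [X in _ / X]mulrC. Qed.

Lemma H_addn (j r m : nat) :
  H (j + r) m = H j m + \sum_(1 <= i < r.+1) (j + i)%:R ^- m.
Proof.
rewrite /H (@big_cat_nat _ _ _ j.+1) ?ltnS ?leq_addr //=; congr (_ + _).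
rewrite -[X in index_iota X _]add1n big_addn -addnS addnC addnK.
by apply: eq_bigr => i _; rewrite addnC.
Qed.

Lemma G_shift (n p r s m : nat) :
  G n p 0 r s m = G (n + r) p 0 0 0 m - G r p 0 0 0 m
                    - \sum_(1 <= i < r.+1) R n m p i r.
Proof.
have -> : G (n + r) p 0 0 0 m - G r p 0 0 0 m
          = \sum_(1 <= j < n.+1) H (j + r) m / (j + r)%:R ^+ p.
  rewrite /G (@big_cat_nat _ _ _ r.+1 1 (n + r).+1) ?ltnS ?leq_addl //=.
  (* The first [r] terms cancel; the others are reindexed from [r.+1 = 1 + r] down to [1]. *)
  rewrite addrAC subrr add0r -[X in index_iota X _]add1n big_addn -addSn addnK.
  by apply: eq_bigr => j _; rewrite addn0 expr0 mulr1.
(* With [j] outermost, the inner sum over [i] is [H (j + r) m - H j m] divided by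
   [(j + r)%:R ^+ p]. *)
rewrite exchange_big_nat -sumrB /=; apply: eq_bigr => j _.
under [X in _ - X]eq_bigr do rewrite mul1r invfM.
by rewrite -mulr_suml -mulrBl H_addn addrK expr0 mulr1.
Qed.

Lemma G_binomial (n p q r s m : nat) : (q <= p)%N -> r <> s ->
  G n p q r s m =
    1 / (s%:R - r%:R) ^+ q
      * \sum_(0 <= i < q.+1) (-1) ^+ i * 'C(q, i)%:R * G n (p - i) i r s m.
Proof.
move=> le_qp /eqP ne_rs.
under [in RHS]eq_bigr do rewrite /G mulr_sumr.
rewrite exchange_big_nat mulr_sumr; apply: eq_big_nat => j /andP[j0 _].
rewrite (inv_expM_binomial _ _ _ le_qp) ?natrD_neq0 //; last first.
  by rewrite Num.Theory.eqr_nat eqn_add2l.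
(* Independence from [j] is what lets the prefactor leave the sum. *)
have -> : (j + s)%:R - (j + r)%:R = s%:R - r%:R :> rat by rewrite !natrD; ring.
rewrite mulrCA mulr_sumr.
by congr (_ * _); apply: eq_bigr => i _; rewrite mulrCA -!mulrA.
Qed.

Theorem theorem1 (m p q r s n : nat) (hm : (1 <= m)%N) (hpq : (1 < p + q)%N)
    (hn : (1 <= n)%N) :
  [/\ q = 0%N ->
        G n p 0 r s m =
          G (n + r) p 0 0 0 m - G r p 0 0 0 m
            - \sum_(1 <= i < r.+1) R n m p i r,
      (q < p)%N -> r <> s ->
        G n p q r s m =
          1 / (s%:R - r%:R) ^+ q
            * \sum_(0 <= i < q.+1) (-1) ^+ i * 'C(q, i)%:R * G n (p - i) i r s m
    & (p < q)%N -> r <> s ->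
        G n p q r s m =
          1 / (r%:R - s%:R) ^+ p
            * \sum_(0 <= i < p.+1) (-1) ^+ i * 'C(p, i)%:R * G n i (q - i) r s m].
Proof.
split=> [_ | lt_qp | lt_pq] *; first exact: G_shift.
  by apply: G_binomial => //; apply: ltnW.
rewrite G_sym (@G_binomial n q p s r m (ltnW lt_pq)); last exact: nesym.
by congr (_ * _); apply: eq_bigr => i _; rewrite G_sym.
Qed.
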